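(* Let $f:\mathbb{R}^n\to\mathbb{R}$ be twice differentiable with finite infimum $f_*$ and $L_2$-Lipschitz Hessian. Let $x_0\in\mathbb{R}^n$, and assume that the sublevel set $L=\{x: f(x)<f(x_0)\}$ satisfies $D:=\sup\{\|x-x_*\| : x\in L\}<\infty$, where $x_*$ is a global minimizer of $f$, and that $\|\nabla f(x)\|\le G$ for all $x\in L$. Let $\rho:\mathbb{R}^n\to\mathbb{R}$ be $\sigma_V$-strongly convex with $L_V$-Lipschitz gradient and $2\sigma_V>L_V$. Fix $\eta>0$ and $\xi\in(0,1)$, and let $(x_k)$ be generated by the algorithm HAT from $x_0$ with matrices $H_k$ and with $r_k$ and $A_k$ given by the parameter choice of HAT (see context). Assume that the relative inexactness $$\Delta=\sup_k \frac{\|\nabla^2 f(x_k)-H_k\|}{\|\nabla f(x_k)\|^{1/2}}$$ is finite. Then HAT needs $\mathcal{O}\left(\varepsilon^{-3/2}\log\frac1\varepsilon\right)$ iterations to reach an $\varepsilon$-approximate first-order stationary point. That is, there is a constant $C>0$, not depending on $\varepsilon$, such that for every $\varepsilon\in(0,1/2]$ there is an index $k\le C\varepsilon^{-3/2}\log\frac1\varepsilon$ with $\|\nabla f(x_k)\|\le\varepsilon$.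
   Context: $\|\cdot\|$ is the Euclidean norm on vectors and the induced operator norm on matrices. $L_2$-Lipschitz Hessian: $\|\nabla^2 f(x)-\nabla^2 f(y)\|\le L_2\|x-y\|$ for all $x,y$. The scaling function $\rho$ is differentiable and satisfies $\rho(y)\ge\rho(x)+\langle\nabla\rho(x),y-x\rangle+\frac{\sigma_V}{2}\|y-x\|^2$ and $\|\nabla\rho(y)-\nabla\rho(x)\|\le L_V\|y-x\|$ for all $x,y$. The Bregman divergence is $V(x,y)=\rho(y)-\rho(x)-\langle\nabla\rho(x),y-x\rangle$. Algorithm HAT. At iteration $k=0,1,\dots$, given $x_k$ with $\nabla f(x_k)\neq0$ (if $\nabla f(x_k)=0$ the method stops), a symmetric matrix $H_k\in\mathbb{R}^{n\times n}$ (an approximation of $\nabla^2 f(x_k)$) and numbers $r_k,A_k$ are chosen; $d_k$ is a global solution of $$\min_{d\in\mathbb{R}^n}\ \langle\nabla f(x_k),d\rangle+\tfrac12\langle H_kd,d\rangle+A_kV(x_k,x_k+d)\quad\text{s.t.}\quad \|d\|^2\le r_k^2\|\nabla f(x_k)\|;$$ and $x_{k+1}=x_k+d_k$. Parameter choice of HAT (with hyperparameters $\eta>0$, $0<\xi<1$): $$r_k=\xi\left(\frac{\|\nabla^2 f(x_k)-H_k\|}{\|\nabla f(x_k)\|^{1/2}}\left(1+\frac{L_V}{2\sigma_V-L_V}\right)+\sqrt{\xi\left(\frac{L_2}{2}+L_V\frac{2\eta+L_2/3}{2\sigma_V-L_V}\right)}\right)^{-1},$$ $$A_k=\frac{\|\nabla^2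 f(x_k)-H_k\|}{2\sigma_V-L_V}+\frac{r_k\|\nabla f(x_k)\|^{1/2}}{2\sigma_V-L_V}\left(2\eta+\frac{L_2}{3}\right).$$ The supremum defining $\Delta$ is over the iterations $k$ performed (those with $\nabla f(x_k)\ne0$). *)

(* Defs.v *)
From HB Require Import structures.
From mathcomp Require Import all_boot all_order all_algebra.
From mathcomp Require Import all_classical all_reals all_analysis.

Set Implicit Arguments.
Unset Strict Implicit.
Unset Printing Implicit Defensive.

Import Order.TTheory GRing.Theory Num.Theory.
Import numFieldNormedType.Exports.

Local Open Scope classical_set_scope.
Local Open Scope ring_scope.

(* Points of R^n are row vectors and a matrix A acts on a vector v as v *m A,
   the convention of the Jacobian 'J.  For symmetric A this is the usual A v. *)

Section Euclidean.
Context {R : realType} {n : nat}.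
Implicit Types (u v : 'rV[R]_n) (A : 'M[R]_n).

Definition dotv u v : R := \sum_(i < n) u 0 i * v 0 i.

(* The library norm `|u| on 'rV[R]_n is the sup norm.  It is used below only
   through the notion of differentiability, which it shares with this one. *)
Definition enorm u : R := Num.sqrt (dotv u u).

(* Transposing A does not change this value, so the side on which A acts is
   irrelevant. *)
Definition opnorm A : R :=
  sup [set enorm (v *m A) | v in [set v | enorm v <= 1]].

End Euclidean.

Section Smooth.
Context {R : realType} {n : nat}.
Implicit Types (f rho : 'rV[R]_n -> R) (x y : 'rV[R]_n).

Definition grad f x : 'rV[R]_n := \row_(i < n) 'D_(delta_mx 0 i) f x.

(* (hess f x) i j is the i-th partial derivative of the j-th component of
   grad f. *)
Definition hess f x : 'M[R]_n := 'J (grad f) x.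

Definition twice_differentiable f : Prop :=
  (forall x, differentiable f x) /\ (forall x, differentiable (grad f) x).

Definition lipschitz_hessian (L2 : R) f : Prop :=
  forall x y, opnorm (hess f x - hess f y) <= L2 * enorm (x - y).

Definition lipschitz_gradient (LV : R) rho : Prop :=
  forall x y, enorm (grad rho y - grad rho x) <= LV * enorm (y - x).

Definition strongly_convex (sigma : R) rho : Prop :=
  0 < sigma /\
  forall x y,
    rho x + dotv (grad rho x) (y - x) + sigma / 2 * enorm (y - x) ^+ 2
      <= rho y.

Definition bregman rho x y : R := rho y - rho x - dotv (grad rho x) (y - x).

End Smooth.

Section HAT.
Context {R : realType} {n : nat}.
Implicit Types (f rho : 'rV[R]_n -> R) (x d : 'rV[R]_n) (H : 'M[R]_n).

Definition HAT_model f rho x H (A : R) d : R :=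
  dotv (grad f x) d + 2^-1 * dotv (d *m H) d + A * bregman rho x (x + d).

Definition HAT_feasible f x (r : R) d : Prop :=
  enorm d ^+ 2 <= r ^+ 2 * enorm (grad f x).

Definition HAT_step f rho x H (r A : R) d : Prop :=
  HAT_feasible f x r d /\
  forall d', HAT_feasible f x r d' ->
    HAT_model f rho x H A d <= HAT_model f rho x H A d'.

(* A run that stops at iteration K is encoded as a sequence that is constant
   from K on.  The iterations performed are then exactly the k with
   grad f (x k) != 0, and H, r, A are unconstrained at the other indices. *)
Definition HAT_run f rho (H : nat -> 'M[R]_n) (r A : nat -> R)
    (x : nat -> 'rV[R]_n) : Prop :=
  forall k,
    if grad f (x k) == 0 then x k.+1 = x k
    else (H k)^T = H k /\
         exists2 d, HAT_step f rho (x k) (H k) (r k) (A k) d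
                  & x k.+1 = x k + d.

Definition rel_inexactness f x H : R :=
  opnorm (hess f x - H) / Num.sqrt (enorm (grad f x)).

Definition HAT_radius f (L2 sigmaV LV eta xi : R) x H : R :=
  xi * (rel_inexactness f x H * (1 + LV / (2 * sigmaV - LV))
        + Num.sqrt (xi * (L2 / 2
            + LV * ((2 * eta + L2 / 3) / (2 * sigmaV - LV)))))^-1.

Definition HAT_weight f (L2 sigmaV LV eta : R) x H (r : R) : R :=
  opnorm (hess f x - H) / (2 * sigmaV - LV)
  + r * Num.sqrt (enorm (grad f x)) / (2 * sigmaV - LV) * (2 * eta + L2 / 3).

End HAT.

(* Main.v *)
Require Import Defs.
From HB Require Import structures.
From mathcomp Require Import all_boot all_order all_algebra.
From mathcomp Require Import all_classical all_reals all_analysis.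
From mathcomp Require Import ring lra.

Set Implicit Arguments.
Unset Strict Implicit.
Unset Printing Implicit Defensive.

Import Order.TTheory GRing.Theory Num.Theory.
Import numFieldNormedType.Exports.

Local Open Scope classical_set_scope.
Local Open Scope ring_scope.

(** Each HAT step either contracts the gradient norm by the factor [xi] or
    decreases [f] by at least a constant times [|grad f x_k|^(3/2)].

    Let [d] be the step from [x], [p] the gradient of the model at [d], and
    [rad = r_k |grad f x|^(1/2)] the bound on [|d|]. Shrinking [d] is feasible,
    so [<p, d> <= 0] ([model_grad_step_le0]); small moves from [d] in any
    direction are feasible when [|d| < rad], so then [p = 0]
    ([model_grad_interior]); and comparing [d] with [- d] bounds
    [<grad f x, d>] ([grad_step_le]). Combined with the Taylor bounds that
    follow from the Lipschitz Hessian ([taylor2_le], [grad_taylor]) these give: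
    - [f (x + d) <= f x - eta * rad * |d|^2] for every step, the weight [A_k]
      being chosen to absorb the Hessian error and the cubic remainder
      ([HAT_step_decrease]);
    - [|grad f (x + d)| <= xi * |grad f x|] for an interior step, the radius
      [r_k] being chosen for this ([HAT_step_contraction]).

    A boundary step has [|d| = rad], so it decreases [f] by [eta * rad^3]. Since
    the relative inexactness is at most [Delta], the radii [r_k] are bounded
    below, and while [|grad f x_k| > eps] this decrease is at least
    [c * eps^(3/2)].

    Hence there are [O(eps^(-3/2))] boundary steps. A boundary step may enlarge
    the gradient, but never beyond its bound on the sublevel set, so at most
    [O(log (1 / eps))] interior steps fit between two boundary steps. The
    product of the two counts is obtained from a single potential, a
    combination of [ln |grad f x_k|] and [f x_k], that drops by at least
    [- ln xi] at every step ([alternating_progress_bound]). *)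

(** * Euclidean norm and operator norm *)

Section EuclideanSpace.
Context {R : realType} {n : nat}.
Implicit Types (u v w : 'rV[R]_n) (A : 'M[R]_n).

Lemma dotvC u v : dotv u v = dotv v u.
Proof. by apply: eq_bigr => i _; rewrite mulrC. Qed.

Lemma dotvDl u v w : dotv (u + v) w = dotv u w + dotv v w.
Proof. by rewrite -big_split; apply: eq_bigr => i _; rewrite mxE mulrDl. Qed.

Lemma dotvZl a u v : dotv (a *: u) v = a * dotv u v.
Proof.
by rewrite /dotv big_distrr; apply: eq_bigr => i _; rewrite mxE -mulrA.
Qed.

Lemma dotvNl u v : dotv (- u) v = - dotv u v.
Proof. by rewrite -scaleN1r dotvZl mulN1r. Qed.

Lemma dotvDr u v w : dotv u (v + w) = dotv u v + dotv u w.
Proof. by rewrite dotvC dotvDl !(dotvC u). Qed.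

Lemma dotvZr a u v : dotv u (a *: v) = a * dotv u v.
Proof. by rewrite dotvC dotvZl dotvC. Qed.

Lemma dotvNr u v : dotv u (- v) = - dotv u v.
Proof. by rewrite dotvC dotvNl dotvC. Qed.

Definition dotvE := (dotvDl, dotvDr, dotvNl, dotvNr, dotvZl, dotvZr).

Lemma dotv_mulmx_tr u v A : dotv (u *m A) v = dotv (v *m A^T) u.
Proof.
have dotvM p q : dotv p q = (p *m q^T) 0 0.
  by rewrite mxE; apply: eq_bigr => i _; rewrite !mxE.
by rewrite dotvC !dotvM trmx_mul mulmxA.
Qed.

Lemma dotv_ge0 u : 0 <= dotv u u.
Proof. by apply: sumr_ge0 => i _; rewrite -expr2 sqr_ge0. Qed.

Lemma enorm_ge0 u : 0 <= enorm u.
Proof. exact: sqrtr_ge0. Qed.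

Lemma sqr_enorm u : enorm u ^+ 2 = dotv u u.
Proof. by rewrite sqr_sqrtr// dotv_ge0. Qed.

Lemma enorm0 : enorm (0 : 'rV[R]_n) = 0.
Proof. by rewrite /enorm -(scale0r 0) dotvZl mul0r sqrtr0. Qed.

Lemma enorm_eq0 u : (enorm u == 0) = (u == 0).
Proof.
apply/eqP/eqP => [u0|->]; last exact: enorm0.
have /eqP : dotv u u = 0 by rewrite -sqr_enorm u0 expr0n.
rewrite psumr_eq0 => [/allP u_eq0|i _]; last by rewrite -expr2 sqr_ge0.
apply/rowP => i; rewrite mxE; apply/eqP.
by have := u_eq0 i (mem_index_enum i); rewrite /= mulf_eq0 orbb.
Qed.

Lemma enorm_gt0 u : (0 < enorm u) = (u != 0).
Proof. by rewrite lt_def enorm_eq0 enorm_ge0 andbT. Qed.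

Lemma enormZ a u : enorm (a *: u) = `|a| * enorm u.
Proof.
by rewrite /enorm dotvZl dotvZr mulrA -expr2 sqrtrM ?sqr_ge0// sqrtr_sqr.
Qed.

Lemma enormN u : enorm (- u) = enorm u.
Proof. by rewrite -scaleN1r enormZ normrN1 mul1r. Qed.

(** Cauchy-Schwarz, from the nonnegativity of
    [|| |v| u - |u| v ||^2 = 2 |u| |v| (|u| |v| - <u, v>)]. *)
Lemma dotv_le u v : dotv u v <= enorm u * enorm v.
Proof.
have [->|u0] := eqVneq u 0; first by rewrite enorm0 -(scale0r 0) dotvZl !mul0r.
have [->|v0] := eqVneq v 0.
  by rewrite enorm0 -(scale0r 0) dotvZr !(mulr0, mul0r).
have uv_gt0 : 0 < enorm u * enorm v by rewrite mulr_gt0// enorm_gt0.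
have := dotv_ge0 (enorm v *: u - enorm u *: v).
rewrite !dotvE (dotvC v u) -!sqr_enorm => uv_ge0.
rewrite -(ler_pM2l uv_gt0); nra.
Qed.

Lemma enormD u v : enorm (u + v) <= enorm u + enorm v.
Proof.
rewrite -(@ler_pXn2r _ 2)// ?nnegrE ?addr_ge0 ?enorm_ge0//.
rewrite sqr_enorm !dotvE (dotvC v u) -!sqr_enorm.
have := dotv_le u v; nra.
Qed.

(** A real supremum bounds its set only if the set is bounded. Here each entry
    of [v *m A] is at most the norm of a column of [A], by Cauchy-Schwarz. *)
Lemma opnorm_has_sup A :
  has_sup [set enorm (v *m A) | v in [set v | enorm v <= 1]].
Proof.
split; first by exists (enorm (0 *m A)), 0 => //=; rewrite enorm0.
pose c j : 'rV[R]_n := (col j A)^T.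
exists (1 + \sum_j enorm (c j) ^+ 2) => _ [v /= v1 <-].
have entry j : `|(v *m A) 0 j| <= enorm (c j).
  have -> : (v *m A) 0 j = dotv v (c j).
    by rewrite mxE; apply: eq_bigr => i _; rewrite !mxE.
  have c0 := enorm_ge0 (c j).
  have := dotv_le v (c j); have := dotv_le (- v) (c j).
  rewrite dotvNl enormN ler_norml; nra.
have : enorm (v *m A) ^+ 2 <= \sum_j enorm (c j) ^+ 2.
  rewrite sqr_enorm; apply: ler_sum => j _.
  by rewrite -expr2 -real_normK ?num_real// lerXn2r ?nnegrE ?enorm_ge0.
by have := enorm_ge0 (v *m A); nra.
Qed.

Lemma opnorm_ge0 A : 0 <= opnorm A.
Proof.
apply: (@le_trans _ _ (enorm (0 *m A))); first exact: enorm_ge0.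
apply: sup_upper_bound; first exact: opnorm_has_sup.
by exists 0 => //=; rewrite enorm0.
Qed.

Lemma enorm_mulmx v A : enorm (v *m A) <= opnorm A * enorm v.
Proof.
have [->|v0] := eqVneq v 0; first by rewrite mul0mx enorm0 mulr0.
have ev0 : 0 < enorm v by rewrite enorm_gt0.
have -> : v *m A = enorm v *: (((enorm v)^-1 *: v) *m A).
  by rewrite -scalemxAl scalerA divff ?scale1r// gt_eqF.
rewrite enormZ (gtr0_norm ev0) [leLHS]mulrC ler_pM2r//.
apply: sup_upper_bound; first exact: opnorm_has_sup.
exists ((enorm v)^-1 *: v) => //=.
have iv0 : 0 < (enorm v)^-1 by rewrite invr_gt0.
by rewrite enormZ (gtr0_norm iv0) mulVf// gt_eqF.
Qed.

Lemma dotv_mulmx_le u v A : dotv (u *m A) v <= opnorm A * enorm u * enorm v.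
Proof.
by apply: (le_trans (dotv_le _ _)); rewrite ler_wpM2r ?enorm_ge0// enorm_mulmx.
Qed.

End EuclideanSpace.

(** * Taylor bounds from a Lipschitz Hessian *)

Section Taylor.
Context {R : realType} {n : nat}.
Implicit Types (f : 'rV[R]_n -> R) (x d w : 'rV[R]_n).

Lemma ler0_is_derive_le01 (phi dphi : R -> R) :
  (forall t : R, is_derive t 1 phi (dphi t)) ->
  (forall t : R, 0 <= t -> dphi t <= 0) -> phi 1 <= phi 0.
Proof.
move=> phiP dphi_le0.
have phi_cont : {within `[0, 1], continuous phi}.
  by apply: derivable_within_continuous => t _; have [] := phiP t.
have [t /[!in_itv]/= /andP[t0 _]] :=
  @MVT R phi dphi 0 1 ltr01 (fun t _ => phiP t) phi_cont.
by rewrite subr0 mulr1 -subr_le0 => ->; exact/dphi_le0/ltW.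
Qed.

Lemma is_derive_line (W : normedModType R) (F : 'rV[R]_n -> W) x d (t : R) :
  differentiable F (x + t *: d) ->
  is_derive t 1 (fun s => F (x + s *: d)) ('D_d F (x + t *: d)).
Proof.
move=> /(diff_derivable (v := d)) Fd.
have E : (fun h => h^-1 *: (((fun s => F (x + s *: d)) \o shift t) (h *: 1)
            - F (x + t *: d))) =
         (fun h => h^-1 *: ((F \o shift (x + t *: d)) (h *: d) - F (x + t *: d))).
  apply/funext => h /=; congr (_ *: (F _ - _)).
  by rewrite [h *: 1]mulr1 scalerDl addrCA.
by apply: DeriveDef; rewrite /derivable /derive E.
Qed.

Lemma is_derive_dotv (M : R -> 'rV[R]_n) dM (t : R) w :
  is_derive t 1 M dM -> is_derive t 1 (fun s => dotv (M s) w) (dotv dM w).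
Proof.
move=> [Mt <-].
have -> : (fun s => dotv (M s) w) = \sum_(i < n) (fun s => M s 0 i * w 0 i).
  by apply/funext => s; rewrite fct_sumE.
apply: is_derive_sum => i.
rewrite derive_mx// mxE [X in is_derive _ _ _ X]mulrC.
have Mi : is_derive t 1 (fun s => M s 0 i) ('D_1 (fun s => M s 0 i) t).
  by apply: derivableP; move/derivable_mxP : Mt; exact.
have -> : (fun s => M s 0 i * w 0 i) = w 0 i \*: (fun s => M s 0 i).
  by apply/funext => s; rewrite mulrC.
exact: is_deriveZ.
Qed.

Lemma derive_dotv_grad f x d :
  differentiable f x -> 'D_d f x = dotv (grad f x) d.
Proof.
move=> fx; rewrite deriveE// {1}(row_sum_delta d) linear_sum.
by apply: eq_bigr => i _; rewrite linearZ/= mxE deriveE// mulrC.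
Qed.

(** Testing the remainder against a fixed vector [w] makes the claim scalar:
    along the segment from [x] to [x + d], the derivative of
    [<grad f (x + t d), w> - t <d hess f x, w> - (L2 / 2) t^2 |d|^2 |w|] is
    nonpositive by the Lipschitz bound on the Hessian. The remainder itself is
    then the right choice of [w]. *)
Lemma grad_taylor f (L2 : R) x d :
  twice_differentiable f -> lipschitz_hessian L2 f ->
  enorm (grad f (x + d) - grad f x - d *m hess f x) <= L2 / 2 * enorm d ^+ 2.
Proof.
move=> [_ grad_diff] hess_lip; set w := _ - d *m _.
have [->|w0] := eqVneq w 0.
  (* the right-hand side is nonnegative: the bound forces 0 <= L2 if d != 0 *)
  rewrite enorm0.
  have [->|d0] := eqVneq d 0; first by rewrite enorm0 expr0n mulr0.
  have := le_trans (opnorm_ge0 _) (hess_lip (x + d) x).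
  rewrite addrC addKr => L2d.
  by rewrite expr2 mulrA mulr_ge0 ?enorm_ge0//; lra.
have ew0 : 0 < enorm w by rewrite enorm_gt0.
rewrite -(ler_pM2r ew0) -[leLHS]expr2 (sqr_enorm w).
pose c := dotv (d *m hess f x) w.
pose b := L2 / 2 * enorm d ^+ 2 * enorm w.
pose phi s := dotv (grad f (x + s *: d)) w - (c *: s + b *: (s * s)).
pose dphi s := dotv (d *m hess f (x + s *: d)) w
  - (c *: 1 + b *: (s *: 1 + s *: 1)).
have phiP (t : R) : is_derive t 1 phi (dphi t).
  apply: is_deriveB; first apply: is_derive_dotv.
    have <- : 'D_d (grad f) (x + t *: d) = d *m hess f (x + t *: d).
      exact: deriveEjacobian.
    exact: is_derive_line.
have : phi 1 <= phi 0.
  apply: (ler0_is_derive_le01 phiP) => t t0.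
  rewrite /dphi.
  have -> : dotv (d *m hess f (x + t *: d)) w
            = dotv (d *m (hess f (x + t *: d) - hess f x)) w + c.
    by rewrite -dotvDl -mulmxDr subrK.
  have tdE : x + t *: d - x = t *: d by rewrite addrC addKr.
  have h2 := dotv_mulmx_le d w (hess f (x + t *: d) - hess f x).
  have := hess_lip (x + t *: d) x.
  rewrite tdE enormZ (ger0_norm t0) => h1.
  have h3 : opnorm (hess f (x + t *: d) - hess f x) * enorm d * enorm w <=
            L2 * (t * enorm d) * enorm d * enorm w.
    by rewrite !ler_wpM2r ?enorm_ge0.
  have := le_trans h2 h3.
  by rewrite /b /GRing.scale/=; lra.
have -> : dotv w w = dotv (grad f (x + d)) w - dotv (grad f x) w - c.
  by rewrite {1}/w !dotvDl !dotvNl.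
by rewrite /phi scale0r addr0 scale1r /GRing.scale/= /b; lra.
Qed.

(** The derivative along the segment of [f] minus its cubic upper model is
    nonpositive by [grad_taylor], applied to each shorter increment. *)
Lemma taylor2_le f (L2 : R) x d :
  twice_differentiable f -> lipschitz_hessian L2 f ->
  f (x + d) <= f x + dotv (grad f x) d + dotv (d *m hess f x) d / 2
               + L2 / 6 * enorm d ^+ 3.
Proof.
move=> f2 hess_lip; have [f_diff grad_diff] := f2.
pose g := dotv (grad f x) d.
pose c := dotv (d *m hess f x) d / 2.
pose b := L2 / 6 * enorm d ^+ 3.
pose phi s := f (x + s *: d) - (g *: s + c *: (s * s) + b *: (s * (s * s))).
pose dphi s := dotv (grad f (x + s *: d)) d
  - (g *: 1 + c *: (s *: 1 + s *: 1)
     + b *: (s *: (s *: 1 + s *: 1) + (s * s) *: 1)).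
have phiP (t : R) : is_derive t 1 phi (dphi t).
  have dE : 'D_d f (x + t *: d) = dotv (grad f (x + t *: d)) d.
    exact: derive_dotv_grad.
  apply: is_deriveB; first by rewrite -dE; exact: is_derive_line.
  apply: is_deriveD; apply: is_deriveZ; apply: is_deriveM.
have : phi 1 <= phi 0.
  apply: (ler0_is_derive_le01 phiP) => t t0.
  have := grad_taylor x (t *: d) f2 hess_lip.
  rewrite enormZ ger0_norm// -scalemxAl => h1.
  have := dotv_le (grad f (x + t *: d) - grad f x - t *: (d *m hess f x)) d.
  have := ler_wpM2r (enorm_ge0 d) h1.
  rewrite !dotvE => h2 h3; have := le_trans h3 h2.
  by rewrite /dphi /g /c /b /GRing.scale/=; lra.
by rewrite /phi scale0r addr0 scale1r /GRing.scale/= /g /c /b; lra.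
Qed.

End Taylor.

(** * Bregman divergence of the scaling function *)

Section ScalingFunction.
Context {R : realType} {n : nat}.
Variables (rho : 'rV[R]_n -> R) (sigma LV : R).
Hypotheses (rho_convex : strongly_convex sigma rho)
  (rho_grad : lipschitz_gradient LV rho).
Implicit Types x d e : 'rV[R]_n.

Lemma strongly_convexD x d :
  rho x + dotv (grad rho x) d + sigma / 2 * enorm d ^+ 2 <= rho (x + d).
Proof. by have := rho_convex.2 x (x + d); rewrite [x + d - x]addrC addKr. Qed.

Lemma lipschitz_gradientD x d :
  enorm (grad rho (x + d) - grad rho x) <= LV * enorm d.
Proof. by have := rho_grad x (x + d); rewrite [x + d - x]addrC addKr. Qed.

Lemma bregmanD x d :
  bregman rho x (x + d) = rho (x + d) - rho x - dotv (grad rho x) d.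
Proof. by rewrite /bregman [x + d - x]addrC addKr. Qed.

Lemma bregman_ge x d : sigma / 2 * enorm d ^+ 2 <= bregman rho x (x + d).
Proof. by rewrite bregmanD; have := strongly_convexD x d; lra. Qed.

Lemma grad_diff_le x d e :
  dotv (grad rho (x + d) - grad rho x) e <= LV * enorm d * enorm e.
Proof.
apply: le_trans (dotv_le _ _) _.
by rewrite ler_wpM2r ?enorm_ge0// lipschitz_gradientD.
Qed.

(** Strong convexity based at the far end of the increment bounds [rho]
    from above, up to the Lipschitz variation of its gradient. *)
Lemma scaling_upper x d :
  rho (x + d) <= rho x + dotv (grad rho x) d + (LV - sigma / 2) * enorm d ^+ 2.
Proof.
have := strongly_convexD (x + d) (- d).
rewrite addrK enormN dotvNr => h.
by have := grad_diff_le x d d; rewrite dotvDl dotvNl; lra.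
Qed.

Lemma bregman_le x d : bregman rho x (x + d) <= (LV - sigma / 2) * enorm d ^+ 2.
Proof. by rewrite bregmanD; have := scaling_upper x d; lra. Qed.

Lemma grad_diff_ge x d :
  sigma * enorm d ^+ 2 <= dotv (grad rho (x + d) - grad rho x) d.
Proof.
have := strongly_convexD (x + d) (- d); have := strongly_convexD x d.
by rewrite addrK enormN dotvNr dotvDl dotvNl; lra.
Qed.

Lemma sigma_le_LV d : d != 0 -> sigma <= LV.
Proof.
rewrite -enorm_gt0 => d0.
have := grad_diff_ge 0 d; have := grad_diff_le 0 d d.
rewrite -mulrA -expr2 => h1 h2; have := le_trans h2 h1.
by rewrite ler_pM2r// exprn_gt0.
Qed.

End ScalingFunction.

(** * Optimality conditions of the subproblem *)

Section Subproblem.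
Context {R : realType} {n : nat}.
Variables (f rho : 'rV[R]_n -> R) (sigma LV : R).
Hypotheses (rho_convex : strongly_convex sigma rho)
  (rho_grad : lipschitz_gradient LV rho).
Variables (x : 'rV[R]_n) (H : 'M[R]_n) (r A : R) (d : 'rV[R]_n).
Hypotheses (H_sym : H^T = H) (A_ge0 : 0 <= A) (r_ge0 : 0 <= r).
Hypothesis d_step : HAT_step f rho x H r A d.
Implicit Types e : 'rV[R]_n.

Definition model_grad : 'rV[R]_n :=
  grad f x + d *m H + A *: (grad rho (x + d) - grad rho x).

Lemma feasibleE e :
  HAT_feasible f x r e <-> enorm e <= r * Num.sqrt (enorm (grad f x)).
Proof.
rewrite /HAT_feasible -{1}(sqr_sqrtr (enorm_ge0 (grad f x))) -exprMn.
by rewrite ler_pXn2r ?nnegrE ?enorm_ge0 ?mulr_ge0 ?sqrtr_ge0.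
Qed.

(** The model lies below a quadratic with slope [model_grad] at [d], which
    turns global optimality of [d] into first-order conditions. *)
Lemma model_upper e :
  HAT_model f rho x H A (d + e) - HAT_model f rho x H A d
    <= dotv model_grad e + (opnorm H / 2 + A * LV) * enorm e ^+ 2.
Proof.
have sigma_gt0 := rho_convex.1.
have rhoe := scaling_upper rho_convex rho_grad (x + d) e.
have He := dotv_mulmx_le e e H.
have Hsym : dotv (e *m H) d = dotv (d *m H) e by rewrite dotv_mulmx_tr H_sym.
have Arho : A * (rho (x + d + e) - rho (x + d) - dotv (grad rho (x + d)) e)
            <= A * (LV * enorm e ^+ 2).
  rewrite ler_wpM2l//.
  by have := sqr_ge0 (enorm e); nra.
rewrite /HAT_model /model_grad !bregmanD addrA mulmxDl !dotvE Hsym.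
by lra.
Qed.

(** A negative slope would dominate the second-order term of [model_upper] for
    short steps, contradicting the optimality of [d]. *)
Lemma feasible_direction e (t0 : R) : 0 < t0 ->
  (forall t, 0 < t -> t <= t0 -> HAT_feasible f x r (d + t *: e)) ->
  0 <= dotv model_grad e.
Proof.
move=> t0_gt0 feas.
set c := (opnorm H / 2 + A * LV) * enorm e ^+ 2.
have quad t : 0 < t -> t <= t0 -> 0 <= dotv model_grad e + t * c.
  move=> t_gt0 t_le; have := d_step.2 _ (feas t t_gt0 t_le).
  rewrite -subr_ge0 => /le_trans /(_ (model_upper _)).
  rewrite dotvZr enormZ (gtr0_norm t_gt0) => h.
  by rewrite -(pmulr_rge0 _ t_gt0); apply: le_trans h _; rewrite /c; lra.
rewrite leNgt; apply/negP; set a := dotv _ _ in quad * => a_lt0.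
have c1_gt0 : 0 < `|c| + 1 by rewrite ltr_wpDl.
(* for this step length the second-order term is at most half of the slope *)
pose t := Num.min t0 (- a / (2 * (`|c| + 1))).
have s_gt0 : 0 < - a / (2 * (`|c| + 1)).
  by rewrite divr_gt0 ?oppr_gt0// mulr_gt0.
have t_gt0 : 0 < t by rewrite lt_min t0_gt0.
have := quad t t_gt0; rewrite ge_min lexx => /(_ isT).
have : t * (`|c| + 1) <= - a / 2.
  apply: (@le_trans _ _ (- a / (2 * (`|c| + 1)) * (`|c| + 1))).
    by rewrite ler_pM2r// ge_min lexx orbT.
  by rewrite le_eqVlt; apply/orP; left; apply/eqP; field; rewrite gt_eqF.
have := ler_wpM2l (ltW t_gt0) (ler_norm c).
by rewrite mulrDr mulr1; lra.
Qed.

(** Shrinking [d] towards the origin stays feasible. *)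
Lemma model_grad_step_le0 : dotv model_grad d <= 0.
Proof.
rewrite -oppr_ge0 -dotvNr; apply: (feasible_direction ltr01) => t t_gt0 t_le1.
have -> : d + t *: - d = (1 - t) *: d by rewrite scalerN scalerBl scale1r.
apply/feasibleE; move/feasibleE : d_step.1; apply: le_trans.
rewrite enormZ ger0_norm ?subr_ge0// ler_piMl ?enorm_ge0//; lra.
Qed.

Lemma model_grad_interior :
  enorm d < r * Num.sqrt (enorm (grad f x)) -> model_grad = 0.
Proof.
move=> d_int; apply/eqP; rewrite -enorm_eq0 -sqrf_eq0 eq_le sqr_ge0 andbT.
rewrite sqr_enorm -oppr_ge0 -dotvNr.
set rad := r * _ in d_int; set p := model_grad.
have p1_gt0 : 0 < enorm p + 1 by rewrite ltr_wpDl ?enorm_ge0.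
have t0_gt0 : 0 < (rad - enorm d) / (enorm p + 1).
  by rewrite divr_gt0// subr_gt0.
apply: (feasible_direction t0_gt0) => t t_gt0.
rewrite ler_pdivlMr// => t_le.
apply/feasibleE; apply: le_trans (enormD _ _) _.
rewrite enormZ enormN (gtr0_norm t_gt0) -/rad -/p; lra.
Qed.

(** The constraint is symmetric, so [- d] is feasible, and the quadratic parts
    of the model agree at [d] and [- d]. *)
Lemma grad_step_le : dotv (grad f x) d <= A * (LV - sigma) / 2 * enorm d ^+ 2.
Proof.
have : HAT_feasible f x r (- d).
  by rewrite /HAT_feasible enormN; exact: d_step.1.
move/d_step.2; rewrite /HAT_model mulNmx !dotvE opprK.
have := ler_wpM2l A_ge0 (bregman_ge rho_convex x d).
have := ler_wpM2l A_ge0 (bregman_le rho_convex rho_grad x (- d)).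
rewrite enormN; lra.
Qed.

End Subproblem.

(** * Progress of one step *)

(** The radius at relative inexactness [Delta]; as the radius decreases with
    the inexactness, this is a lower bound for the radii along the run. *)
Definition HAT_radius_lb (R : realType) (L2 sigma LV eta xi Delta : R) : R :=
  xi / (Delta * (1 + LV / (2 * sigma - LV))
        + Num.sqrt (xi * (L2 / 2
            + LV * ((2 * eta + L2 / 3) / (2 * sigma - LV))))).

Section Step.
Context {R : realType} {n : nat}.
Variables (f rho : 'rV[R]_n -> R) (L2 sigma LV eta xi : R).
Hypotheses (f_diff2 : twice_differentiable f)
  (f_hess : lipschitz_hessian L2 f)
  (rho_convex : strongly_convex sigma rho)
  (rho_grad : lipschitz_gradient LV rho)
  (sigma_LV : LV < 2 * sigma)
  (eta_gt0 : 0 < eta) (xi_gt0 : 0 < xi) (xi_lt1 : xi < 1).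
Variables (x : 'rV[R]_n) (H : 'M[R]_n).
Hypothesis grad_neq0 : grad f x != 0.

Let gap := 2 * sigma - LV.
Let kappa := 1 + LV / gap.
Let curv := L2 / 2 + LV * ((2 * eta + L2 / 3) / gap).
Let sg := Num.sqrt (enorm (grad f x)).
Let rel := rel_inexactness f x H.
Let r := HAT_radius f L2 sigma LV eta xi x H.
Let A := HAT_weight f L2 sigma LV eta x H r.

Let gap_gt0 : 0 < gap. Proof. by rewrite subr_gt0. Qed.

Let sigma_gt0 : 0 < sigma. Proof. exact: rho_convex.1. Qed.

Let sigma_le : sigma <= LV.
Proof. exact: (sigma_le_LV rho_convex rho_grad grad_neq0). Qed.

Let L2_ge0 : 0 <= L2.
Proof.
have := le_trans (opnorm_ge0 _) (f_hess (grad f x) 0).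
by rewrite subr0 pmulr_lge0// enorm_gt0.
Qed.

Let sg_gt0 : 0 < sg. Proof. by rewrite sqrtr_gt0 enorm_gt0. Qed.

Let sqr_sg : sg ^+ 2 = enorm (grad f x).
Proof. by rewrite sqr_sqrtr ?enorm_ge0. Qed.

Let rel_ge0 : 0 <= rel. Proof. by rewrite divr_ge0 ?opnorm_ge0 ?sqrtr_ge0. Qed.

Let opnormE : opnorm (hess f x - H) = rel * sg.
Proof. by rewrite /rel /rel_inexactness -/sg divfK// gt_eqF. Qed.

Let kappa_gt0 : 0 < kappa.
Proof. by rewrite ltr_wpDr// divr_ge0// ltW// (lt_le_trans sigma_gt0). Qed.

Let curv_gt0 : 0 < curv.
Proof.
apply: ltr_wpDl; first by rewrite divr_ge0.
apply: mulr_gt0; first exact: lt_le_trans sigma_le.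
by rewrite divr_gt0//; have := eta_gt0; have := L2_ge0; lra.
Qed.

Let root := Num.sqrt (xi * curv).

Let root_gt0 : 0 < root. Proof. by rewrite sqrtr_gt0 mulr_gt0. Qed.

Let rE : r = xi / (rel * kappa + root). Proof. by []. Qed.

Let den_gt0 : 0 < rel * kappa + root.
Proof. by rewrite ltr_wpDl// mulr_ge0// ltW. Qed.

Lemma HAT_radius_gt0 : 0 < r.
Proof. by rewrite rE divr_gt0. Qed.

Lemma HAT_radius_lb_gt0 Delta : rel <= Delta ->
  0 < HAT_radius_lb L2 sigma LV eta xi Delta.
Proof.
move=> relD; have Delta_ge0 := le_trans rel_ge0 relD.
rewrite /HAT_radius_lb -/gap -/kappa -/curv -/root divr_gt0// ltr_wpDl//.
by rewrite mulr_ge0// ltW.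
Qed.

Lemma HAT_radius_ge Delta : rel <= Delta ->
  HAT_radius_lb L2 sigma LV eta xi Delta <= r.
Proof.
move=> relD; rewrite rE /HAT_radius_lb -/gap -/kappa -/curv -/root.
have relDk : rel * kappa <= Delta * kappa by rewrite ler_pM2r.
have D_ge : rel * kappa + root <= Delta * kappa + root by rewrite lerD2r.
by rewrite ler_pM2l// lef_pV2 ?posrE// (lt_le_trans den_gt0).
Qed.

(** The radius is calibrated by this inequality: writing [a = rel * kappa] and
    [s = sqrt (xi * curv)], it reads
    [a / (a + s) + (s / (a + s)) ^ 2 <= 1] after division by [xi]. *)
Let radius_contraction : r * (rel * kappa) + r ^+ 2 * curv <= xi.
Proof.
have root2 : root ^+ 2 = xi * curv.
  by rewrite sqr_sqrtr// mulr_ge0// ltW.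
have r_gt0 := HAT_radius_gt0.
have rden : r * (rel * kappa + root) = xi by rewrite rE divfK// gt_eqF.
have rroot : r * root <= xi.
  by rewrite -rden ler_pM2l// lerDr mulr_ge0// ltW.
have : xi * (r ^+ 2 * curv) <= xi * (r * root).
  have -> : xi * (r ^+ 2 * curv) = (r * root) * (r * root).
    by rewrite mulrCA -root2; ring.
  by rewrite ler_wpM2r// mulr_ge0// ltW.
rewrite ler_pM2l// => curv_le.
by rewrite -[leRHS]rden [leRHS]mulrDr lerD2l.
Qed.

Let AE : A * gap = rel * sg + r * sg * (2 * eta + L2 / 3).
Proof.
by rewrite /A /HAT_weight opnormE -/gap -/sg; field; rewrite gt_eqF.
Qed.

Let A_ge0 : 0 <= A.
Proof.
rewrite -(pmulr_lge0 _ gap_gt0) AE.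
have sg_ge0 := ltW sg_gt0; have r_ge0 := ltW HAT_radius_gt0.
apply: addr_ge0; first exact: mulr_ge0.
apply: mulr_ge0; first exact: mulr_ge0.
by have := eta_gt0; have := L2_ge0; lra.
Qed.

Hypothesis H_sym : H^T = H.
Variable d : 'rV[R]_n.
Hypothesis d_step : HAT_step f rho x H r A d.

Let d_le : enorm d <= r * sg.
Proof. by apply/feasibleE; [exact/ltW/HAT_radius_gt0 | exact: d_step.1]. Qed.

(** The condition [<model_grad, d> <= 0] bounds the quadratic form of [H] by
    [<grad f x, d>] and the gradient variation of the scaling function; the
    weight is exactly large enough to absorb the Hessian error and the cubic
    remainder, leaving [eta * radius * |d|^2]. *)
Lemma HAT_step_decrease :
  f (x + d) <= f x - eta * (r * sg) * enorm d ^+ 2.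
Proof.
have r_ge0 := ltW HAT_radius_gt0.
have T := taylor2_le x d f_diff2 f_hess.
have P := model_grad_step_le0 rho_convex rho_grad H_sym A_ge0 r_ge0 d_step.
have Q := grad_step_le rho_convex rho_grad A_ge0 d_step.
have := ler_wpM2l A_ge0 (grad_diff_ge rho_convex x d).
rewrite /model_grad dotvDl [dotv (_ + d *m H) _]dotvDl dotvZl in P => S.
have E := dotv_mulmx_le d d (hess f x - H).
rewrite opnormE mulmxBr dotvDl dotvNl -mulrA -expr2 in E.
have N_ge0 := sqr_ge0 (enorm d).
have cubic : L2 / 6 * enorm d ^+ 3 <= L2 / 6 * (r * sg) * enorm d ^+ 2.
  by rewrite exprS mulrA ler_wpM2r// ler_wpM2l// divr_ge0.
have weight : (rel * sg + r * sg * (2 * eta + L2 / 3)) * enorm d ^+ 2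
              <= A * (3 * sigma - LV) / 2 * enorm d ^+ 2.
  rewrite ler_wpM2r// -AE.
  have := mulr_ge0 A_ge0 (_ : 0 <= LV - sigma); rewrite subr_ge0 => /(_ sigma_le).
  by rewrite /gap; lra.
lra.
Qed.

(** In the interior the gradient of the model vanishes, so the new gradient
    consists only of error terms; the radius makes them a fraction [xi] of
    the old gradient. *)
Lemma HAT_step_contraction : enorm d < r * sg ->
  enorm (grad f (x + d)) <= xi * enorm (grad f x).
Proof.
move=> d_int; have r_ge0 := ltW HAT_radius_gt0.
have p0 := model_grad_interior rho_convex rho_grad H_sym A_ge0 r_ge0 d_step d_int.
pose rem := grad f (x + d) - grad f x - d *m hess f x.
pose E := d *m (hess f x - H).
pose S := A *: (grad rho (x + d) - grad rho x).
have -> : grad f (x + d) = rem + E - S.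
  rewrite -[LHS](subr0 _) -{1}p0 /model_grad -/S /rem /E mulmxBr !opprD.
  rewrite !addrA; congr (_ - S).
  by rewrite subrK [RHS]addrAC addrAC.
have rem_le : enorm rem <= L2 / 2 * enorm d ^+ 2 by exact: grad_taylor.
have E_le : enorm E <= rel * sg * enorm d by rewrite -opnormE enorm_mulmx.
have S_le : enorm S <= A * (LV * enorm d).
  by rewrite enormZ ger0_norm// ler_wpM2l// lipschitz_gradientD.
apply: le_trans (enormD _ _) _; rewrite enormN.
have := enormD rem E => remE.
have LV_gt0 : 0 < LV by exact: lt_le_trans sigma_le.
have d_ge0 := enorm_ge0 d.
have radius : enorm d ^+ 2 <= (r * sg) ^+ 2.
  by rewrite lerXn2r ?nnegrE// (le_trans d_ge0).
have L2h_ge0 : 0 <= L2 / 2 by rewrite divr_ge0.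
have relsg_ge0 : 0 <= rel * sg by rewrite mulr_ge0 ?(ltW sg_gt0).
have ALV_ge0 : 0 <= A * LV by rewrite mulr_ge0 ?(ltW LV_gt0).
have h1 := ler_wpM2l L2h_ge0 radius.
have h2 := ler_wpM2l relsg_ge0 d_le.
have h3 := ler_wpM2l ALV_ge0 d_le.
have -> : xi * enorm (grad f x) = xi * sg ^+ 2 by rewrite sqr_sg.
have := ler_wpM2r (sqr_ge0 sg) radius_contraction.
suff -> : (r * (rel * kappa) + r ^+ 2 * curv) * sg ^+ 2 =
  L2 / 2 * (r * sg) ^+ 2 + rel * sg * (r * sg) + A * LV * (r * sg) by lra.
have -> : A = (rel * sg + r * sg * (2 * eta + L2 / 3)) / gap.
  by rewrite -AE mulfK// gt_eqF.
by rewrite /kappa /curv; field; rewrite gt_eqF.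
Qed.

Lemma HAT_step_strict : f (x + d) < f x.
Proof.
apply: le_lt_trans HAT_step_decrease _.
have rad_gt0 : 0 < r * sg by rewrite mulr_gt0// HAT_radius_gt0.
rewrite ltrBlDr ltrDl; apply: mulr_gt0; first exact: mulr_gt0.
rewrite exprn_gt0// enorm_gt0.
apply/eqP => d0; have : enorm d < r * sg by rewrite d0 enorm0.
move/HAT_step_contraction; rewrite d0 addr0 leNgt => /negP; apply.
by rewrite gtr_pMl// enorm_gt0.
Qed.

(** An interior step contracts the gradient; a step on the boundary of the
    trust region has length at least [lb * sqrt |grad f x|], hence decreases
    [f] by the cube of that length. *)
Lemma HAT_progress lb : 0 <= lb -> lb <= r ->
  enorm (grad f (x + d)) <= xi * enorm (grad f x) \/
  f (x + d) <= f x - eta * lb ^+ 3 * Num.sqrt (enorm (grad f x)) ^+ 3.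
Proof.
move=> lb_ge0 lb_le; rewrite -/sg.
have [d_int|d_bd] := ltP (enorm d) (r * sg).
  by left; exact: HAT_step_contraction.
right; apply: le_trans HAT_step_decrease _.
have sg_ge0 := ltW sg_gt0.
have lbsg_ge0 : 0 <= lb * sg by rewrite mulr_ge0.
have lbsg_le : lb * sg <= r * sg by rewrite ler_wpM2r.
rewrite lerD2l lerN2 -mulrA -exprMn -[leRHS]mulrA ler_pM2l// exprS.
rewrite ler_pM ?exprn_ge0// lerXn2r ?nnegrE ?enorm_ge0//.
exact: le_trans d_bd.
Qed.

End Step.

(** * Counting iterations *)

(** The potential [ln (gam k) + W / delta * phi k], with
    [W = ln (Gm / eps) - ln xi], drops by at least [- ln xi] at every step: a
    contraction step acts on the first term, and a decrease of [phi] by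
    [delta] pays for the largest growth that the first term can have while
    [gam] stays in [[eps, Gm]]. *)
Lemma alternating_progress_bound (R : realType) (gam phi : nat -> R)
    (xi eps Gm delta phi_min : R) (K : nat) :
  0 < xi -> xi < 1 -> 0 < eps -> 0 < delta ->
  (forall k, (k <= K)%N -> eps < gam k <= Gm) ->
  (forall k, (k <= K)%N -> phi_min <= phi k) ->
  (forall k, (k < K)%N -> phi k.+1 <= phi k) ->
  (forall k, (k < K)%N ->
     gam k.+1 <= xi * gam k \/ phi k.+1 <= phi k - delta) ->
  K%:R * - ln xi <= (ln Gm - ln eps)
    + (ln Gm - ln eps - ln xi) / delta * (phi 0%N - phi_min).
Proof.
move=> xi_gt0 xi_lt1 eps_gt0 delta_gt0 gamP phi_ge phi_le progress.
have gam_gt0 k : (k <= K)%N -> 0 < gam k.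
  by move=> /gamP/andP[/ltW epsg _]; exact: lt_le_trans epsg.
have ln_bounds k : (k <= K)%N -> ln eps <= ln (gam k) <= ln Gm.
  move=> kK; have /andP[/ltW epsg gG] := gamP k kK; have g0 := gam_gt0 k kK.
  by rewrite !ler_ln ?posrE ?epsg ?gG// (lt_le_trans g0).
have lnxi_lt0 : ln xi < 0 by rewrite ln_lt0// xi_gt0.
set W := ln Gm - ln eps - ln xi.
have W_ge0 : 0 <= W by have := ln_bounds 0%N (leq0n _); rewrite /W; lra.
have Wd_ge0 : 0 <= W / delta by rewrite divr_ge0// ltW.
have pot k : (k <= K)%N ->
    ln (gam k) + W / delta * phi k + k%:R * - ln xi
      <= ln (gam 0%N) + W / delta * phi 0%N.
  elim: k => [_|k IH kK]; first by rewrite mul0r addr0.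
  have {}IH := IH (ltnW kK).
  have gk0 := gam_gt0 k (ltnW kK); have gk1 := gam_gt0 k.+1 kK.
  rewrite -natr1; have [contr|decr] := progress k kK.
    have : ln (gam k.+1) <= ln xi + ln (gam k).
      by rewrite -lnM ?posrE// ler_ln ?posrE// mulr_gt0.
    by have := ler_wpM2l Wd_ge0 (phi_le k kK); lra.
  have := ler_wpM2l Wd_ge0 decr; rewrite mulrBr divfK ?gt_eqF//.
  have := ln_bounds k (ltnW kK); have := ln_bounds k.+1 kK.
  by rewrite {3}/W; lra.
have := pot K (leqnn K); have := ln_bounds K (leqnn K).
have := ln_bounds 0%N (leq0n K).
have := ler_wpM2l Wd_ge0 (phi_ge K (leqnn K)); lra.
Qed.

Lemma powRN32 (R : realType) (e : R) : 0 < e ->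
  e `^ (- (3 / 2)) = (Num.sqrt e ^+ 3)^-1.
Proof.
move=> e_gt0; rewrite powRN mulrC powRrM powR12_sqrt ?ltW//.
by rewrite powR_mulrn ?sqrtr_ge0.
Qed.

Lemma ereal_sup_ubound_fin (R : realType) (T : Type) (P : set T) (F : T -> R) :
  (ereal_sup [set (F t)%:E | t in P] < +oo)%E ->
  exists B, forall t, P t -> F t <= B.
Proof.
move=> sup_fin.
have ub t : P t -> ((F t)%:E <= ereal_sup [set (F t)%:E | t in P])%E.
  by move=> Pt; apply: ereal_sup_ubound; exists t.
case: ereal_sup sup_fin ub => [s _ ub| //|_ ub].
  by exists s => t /ub; rewrite lee_fin.
by exists 0 => t /ub.
Qed.

(** Since [eps <= 1 / 2], the factors [eps `^ (- (3 / 2))] and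
    [ln (1 / eps)] are at least [1] and [ln 2], so they absorb all constants. *)
Lemma iteration_count_bound (R : realType) (l g F c : R) :
  0 < l -> 0 <= g -> 0 <= F -> 0 < c ->
  exists2 C : R, 0 < C & forall eps, 0 < eps -> eps <= 1 / 2 ->
    ((g - ln eps) + (g - ln eps + l) / (c * Num.sqrt eps ^+ 3) * F) / l + 1
      <= C * (eps `^ (- (3 / 2)) * ln (1 / eps)).
Proof.
move=> l_gt0 g_ge0 F_ge0 c_gt0.
have ln2_gt0 : 0 < ln 2 :> R by rewrite ln_gt0// ltr1n.
pose C0 := g / ln 2 + 1; pose C1 := (C0 + l / ln 2) * (F / c).
have C0_ge1 : 1 <= C0 by rewrite lerDr divr_ge0// ltW.
have C1_ge0 : 0 <= C1.
  apply: mulr_ge0; last by rewrite divr_ge0// ltW.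
  by apply: addr_ge0; [exact: le_trans C0_ge1 | rewrite divr_ge0// ltW].
exists ((C0 + C1) / l + (ln 2)^-1).
  by rewrite ltr_wpDl ?invr_gt0// divr_ge0// ?(ltW l_gt0)//; lra.
move=> eps eps_gt0 eps_le.
have lnE : ln (1 / eps) = - ln eps by rewrite div1r lnV.
set Lam := ln (1 / eps); set E := eps `^ _.
have Lam_ge : ln 2 <= Lam.
  rewrite ler_ln ?posrE ?divr_gt0// ler_pdivlMr//; lra.
have Lam_gt0 : 0 < Lam by exact: lt_le_trans Lam_ge.
have EE : E = (Num.sqrt eps ^+ 3)^-1 by exact: powRN32.
have E_ge1 : 1 <= E.
  rewrite EE invf_ge1 ?exprn_gt0 ?sqrtr_gt0// exprn_ile1 ?sqrtr_ge0//.
  by rewrite -[leRHS]sqrtr1 ler_wsqrtr//; lra.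
have absorb a : 0 <= a -> a <= a / ln 2 * Lam.
  by move=> a_ge0; rewrite mulrAC ler_pdivlMr// ler_wpM2l.
have gLam : g - ln eps <= C0 * Lam.
  by rewrite -lnE -/Lam /C0 mulrDl mul1r lerD2r absorb.
have lLam := absorb l (ltW l_gt0).
have EF_ge0 : 0 <= E * (F / c).
  by rewrite mulr_ge0 ?divr_ge0 ?(ltW c_gt0)// (le_trans ler01).
have -> : (g - ln eps + l) / (c * Num.sqrt eps ^+ 3) * F
          = (g - ln eps + l) * (E * (F / c)).
  by rewrite EE invfM; ring.
have h1 : (g - ln eps + l) * (E * (F / c)) <= C1 * (E * Lam).
  have -> : C1 * (E * Lam) = ((C0 + l / ln 2) * Lam) * (E * (F / c)).
    by rewrite /C1; ring.
  by rewrite ler_wpM2r// mulrDl lerD.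
have LamE : Lam <= E * Lam by rewrite ler_pMl.
have h2 : g - ln eps <= C0 * (E * Lam).
  by apply: le_trans gLam _; rewrite ler_wpM2l// (le_trans ler01).
have h3 : 1 <= (ln 2)^-1 * (E * Lam).
  by rewrite mulrC ler_pdivlMr// mul1r (le_trans Lam_ge).
rewrite [leRHS]mulrDl lerD// [leRHS]mulrAC ler_pM2r ?invr_gt0//.
by rewrite [leRHS]mulrDl; exact: lerD.
Qed.

(** * Complexity of HAT *)

Theorem theorem2 (R : realType) (n : nat)
  (f rho : 'rV[R]_n -> R) (L2 sigmaV LV G eta xi : R)
  (x0 xstar : 'rV[R]_n)
  (H : nat -> 'M[R]_n) (r A : nat -> R) (x : nat -> 'rV[R]_n)
  (f_diff2 : twice_differentiable f)
  (f_inf : has_inf (range f))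
  (f_hess : lipschitz_hessian L2 f)
  (xstar_min : forall y, f xstar <= f y)
  (D_fin : (ereal_sup [set (enorm (y - xstar))%:E
                        | y in [set y | (f y < f x0)%R]] < +oo)%E)
  (grad_le : forall y, f y < f x0 -> enorm (grad f y) <= G)
  (rho_diff : forall y, differentiable rho y)
  (rho_convex : strongly_convex sigmaV rho)
  (rho_grad : lipschitz_gradient LV rho)
  (sigmaV_LV : LV < 2 * sigmaV)
  (eta_gt0 : 0 < eta) (xi_gt0 : 0 < xi) (xi_lt1 : xi < 1)
  (x_init : x 0%N = x0)
  (x_run : HAT_run f rho H r A x)
  (r_def : forall k, grad f (x k) != 0 ->
     r k = HAT_radius f L2 sigmaV LV eta xi (x k) (H k))
  (A_def : forall k, grad f (x k) != 0 ->
     A k = HAT_weight f L2 sigmaV LV eta (x k) (H k) (r k))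
  (Delta_fin : (ereal_sup [set (rel_inexactness f (x k) (H k))%:E
                            | k in [set k | grad f (x k) != 0%R]] < +oo)%E) :
  exists2 C : R, 0 < C &
    forall eps : R, 0 < eps -> eps <= 1 / 2 ->
      exists2 k : nat,
        k%:R <= C * (eps `^ (- (3 / 2)) * ln (1 / eps))
        & enorm (grad f (x k)) <= eps.
Proof.
have [g0|g0] := eqVneq (grad f x0) 0.
  exists 1 => // eps eps_gt0 eps_le.
  exists 0%N; last by rewrite x_init g0 enorm0 ltW.
  rewrite mul1r mulr_ge0 ?powR_ge0// ln_ge0// ler_pdivlMr//; lra.
have [Delta rel_le] := ereal_sup_ubound_fin Delta_fin.
have rel0_le : rel_inexactness f (x 0%N) (H 0%N) <= Delta.
  by apply: rel_le; rewrite /= x_init.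
pose lb := HAT_radius_lb L2 sigmaV LV eta xi Delta.
have lb_gt0 : 0 < lb.
  apply: (HAT_radius_lb_gt0 f_hess rho_convex rho_grad sigmaV_LV
    eta_gt0 xi_gt0 _ rel0_le).
  by rewrite x_init.
have step k : grad f (x k) != 0 -> f (x k.+1) < f (x k) /\
    (enorm (grad f (x k.+1)) <= xi * enorm (grad f (x k)) \/
     f (x k.+1) <=
       f (x k) - eta * lb ^+ 3 * Num.sqrt (enorm (grad f (x k))) ^+ 3).
  move=> gk; have := x_run k; rewrite (negbTE gk) => -[H_sym [d d_step ->]].
  rewrite A_def// r_def// in d_step.
  split; first exact: (HAT_step_strict f_diff2 f_hess rho_convex rho_grad
    sigmaV_LV eta_gt0 xi_gt0 xi_lt1 gk H_sym d_step).
  apply: (HAT_progress f_diff2 f_hess rho_convex rho_grad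
    sigmaV_LV eta_gt0 xi_gt0 gk H_sym d_step); first exact: ltW.
  exact: (HAT_radius_ge f_hess rho_convex rho_grad sigmaV_LV eta_gt0 xi_gt0
    gk (rel_le k gk)).
(* the gradient bound concerns the strict sublevel set, which omits x0 *)
pose Gm := Num.max 1 (Num.max G (enorm (grad f x0))).
have Gm_ge1 : 1 <= Gm by rewrite le_max lexx.
have c_gt0 : 0 < eta * lb ^+ 3 by rewrite mulr_gt0 ?exprn_gt0.
have l_gt0 : 0 < - ln xi by rewrite oppr_gt0 ln_lt0// xi_gt0.
have F_ge0 : 0 <= f x0 - f xstar by rewrite subr_ge0.
have [C C_gt0 C_bound] := iteration_count_bound l_gt0 (ln_ge0 Gm_ge1) F_ge0 c_gt0.
exists C => // eps eps_gt0 eps_le.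
have := C_bound eps eps_gt0 eps_le; set B := _ / - ln xi => B_le.
have s_gt0 : 0 < Num.sqrt eps ^+ 3 by rewrite exprn_gt0 ?sqrtr_gt0.
pose K := (Num.truncn B).+1.
have [[k [kK gk]]|no_k] :=
  pselect (exists k, (k <= K)%N /\ enorm (grad f (x k)) <= eps).
  exists k => //; apply: le_trans B_le.
  have B_ge0 : 0 <= B.
    have lneps : ln eps <= 0 by rewrite ln_le0//; lra.
    have := ln_ge0 Gm_ge1 => lnG.
    apply: divr_ge0; last exact: ltW.
    apply: addr_ge0; first by lra.
    apply: mulr_ge0 => //; apply: divr_ge0; first by lra.
    exact/ltW/mulr_gt0.
  have /andP[tB _] := truncn_itv B_ge0.
  by apply: (@le_trans _ _ K%:R); rewrite ?ler_nat// -natr1 lerD2r.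
exfalso.
have gk k : (k <= K)%N -> eps < enorm (grad f (x k)).
  by move=> kK; rewrite ltNge; apply/negP => gk; apply: no_k; exists k.
have gk_neq0 k : (k <= K)%N -> grad f (x k) != 0.
  by move=> /gk epsg; rewrite -enorm_gt0 (lt_trans eps_gt0).
have f_decr k : (k < K)%N -> f (x k.+1) < f x0.
  elim: k => [|k IH] kK.
    by have [+ _] := step 0%N (gk_neq0 0%N isT); rewrite x_init.
  by have [fk _] := step k.+1 (gk_neq0 _ (ltnW kK));
    exact: lt_trans fk (IH (ltnW kK)).
have gk_le k : (k <= K)%N -> enorm (grad f (x k)) <= Gm.
  case: k => [_|k kK]; first by rewrite x_init !le_max lexx !orbT.
  by rewrite !le_max grad_le ?orbT// f_decr.
have := @alternating_progress_bound R (fun k => enorm (grad f (x k)))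
  (fun k => f (x k)) xi eps Gm (eta * lb ^+ 3 * Num.sqrt eps ^+ 3) (f xstar) K
  xi_gt0 xi_lt1 eps_gt0 (mulr_gt0 c_gt0 s_gt0).
rewrite x_init => bound.
suff : K%:R <= B by rewrite leNgt truncnS_gt.
rewrite ler_pdivlMr//; apply: bound => k kK //.
- by rewrite gk ?gk_le.
- by have [/ltW] := step k (gk_neq0 _ (ltnW kK)).
have [_ [contr|decr]] := step k (gk_neq0 _ (ltnW kK)); [by left|right].
apply: le_trans decr _; rewrite lerD2l lerN2 ler_pM2l//.
by rewrite lerXn2r ?nnegrE ?sqrtr_ge0// ler_wsqrtr// ltW// gk// ltnW.
Qed.
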